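(* Let $T>0$ and consider the market with two risky assets $S^{(1)},S^{(2)}$ with semi-Markov stochastic volatilities $\sigma^{(1)}(x_t,\gamma(t))$, $\sigma^{(2)}(x_t,\gamma(t))$ described in the context, with $(x_0,\gamma(0))=(x,0)$. Let $$Cov_R(S^{(1)},S^{(2)})=\frac1T[\ln S^{(1)}_T,\ln S^{(2)}_T]=\frac1T\int_0^T\rho_t\,\sigma^{(1)}(x_t,\gamma(t))\,\sigma^{(2)}(x_t,\gamma(t))\,dt$$ be the realized covariance. Then the value of the covariance swap, $P_{cov}(x)=\mathbb{E}\{e^{-rT}(Cov_R(S^{(1)},S^{(2)})-K_{cov})\}$, is $$P_{cov}(x)=e^{-rT}\left\{\frac1T\int_0^T\rho_t\,e^{tQ}[\sigma^{(1)}(x,0)\sigma^{(2)}(x,0)]\,dt-K_{cov}\right\}.$$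
   Context: Semi-Markov process. Let $(X,\mathscr{X})$ be a measurable space and $Q_{SM}(x,B,t)=P(x,B)G_x(t)$ ($x\in X$, $B\in\mathscr{X}$, $t\ge 0$) a semi-Markov kernel, where $P$ is a transition probability kernel on $X$ and $G_x$ is a distribution function on $\mathbb{R}_+$ with density $g_x(t)=\frac{dG_x(t)}{dt}$; write $\overline{G}_x(t)=1-G_x(t)$. Let $(x_n,\tau_n)_{n\in\mathbb{N}}$ be a Markov renewal process with this kernel, i.e. $\mathbb{P}(x_{n+1}\in B,\tau_{n+1}-\tau_n\le t\mid\mathscr{F}_n)=Q_{SM}(x_n,B,t)$. Put $\nu(t)=\sup\{n:\tau_n\le t\}$, $x_t=x_{\nu(t)}$ (the semi-Markov process) and $\gamma(t)=t-\tau_{\nu(t)}$ (the backward recurrence time). The pair $(x_t,\gamma(t))_{t\ge0}$ is a Markov process on $X\times\mathbb{R}_+$ with generator $$Qf(x,t)=\frac{df}{dt}(x,t)+\frac{g_x(t)}{\overline{G}_x(t)}\int_X P(x,dy)\,[f(y,0)-f(x,t)].$$ The process starts at $(x_0,\gamma(0))=(x,0)$. Notation. $(e^{tQ})_{t\ge0}$ is the operator semigroup generated by $Q$, acting on functions on $X\times\mathbb{R}_+$; $e^{tQ}[\sigma^{(1)}(x,0)\sigma^{(2)}(x,0)]$ means $e^{tQ}$ applied to the product function $\sigma^{(1)}\sigma^{(2)}$, evaluated at $(x,0)$. Market. The risky assets satisfy $dS^{(i)}_t=S^{(i)}_t(\mu^{(i)}_t\,dt+\sigma^{(i)}(x_t,\gamma(t))\,dw^{(i)}_t)$,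 $i=1,2$, where $\mu^{(1)},\mu^{(2)}$ are deterministic functions of time, $\sigma^{(1)},\sigma^{(2)}$ are functions on $X\times\mathbb{R}_+$, and $w^{(1)},w^{(2)}$ are standard Wiener processes, independent of $(x,\gamma)$, with $d[w^{(1)}_t,w^{(2)}_t]=\rho_t\,dt$ for a deterministic function $\rho_t$. There is also a risk-free bond with rate $r$. $\mathbb{E}$ is taken in the risk-neutral world (minimal martingale measure), under which $(x_t,\gamma(t))_{t\ge0}$ is a Markov process on $X\times\mathbb{R}_+$ with generator $Q$ started at $(x,0)$. $K_{cov}$ is a constant (the strike); the notional amount is $1$. The functions $\sigma^{(i)}$ and $\rho$ are understood to be such that the displayed expressions are well defined. *)

(* Defs.v *)
From HB Require Import structures.
From mathcomp Require Import all_boot all_order all_algebra.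
From mathcomp Require Import all_classical all_reals all_analysis.

Set Implicit Arguments.
Unset Strict Implicit.
Unset Printing Implicit Defensive.

Import Order.TTheory GRing.Theory Num.Theory.
Import numFieldNormedType.Exports.

Local Open Scope classical_set_scope.
Local Open Scope ring_scope.

(** Processes are indexed by [R], but only times in [0, +oo[ are ever used. *)

Section processes.
Context (R : realType) (d : measure_display) (Om : measurableType d).
Implicit Types (P : probability Om R) (F : R -> set (set Om)).

Definition history (I : Type) (d' : measure_display) (U : measurableType d')
    (J : set I) (Y : I -> Om -> U) : set (set Om) :=
  <<s [set A | exists2 i, J i & exists2 B, measurable B & A = Y i @^-1` B] >>.

Definition independent_classes P (C1 C2 : set (set Om)) :=
  forall A B, C1 A -> C2 B -> P (A `&` B) = (P A * P B)%E.

Record filtration F : Prop := {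
  filtration_sigma : forall t, 0 <= t -> sigma_algebra setT (F t) ;
  filtration_sub : forall t, 0 <= t -> F t `<=` measurable ;
  filtration_mono : forall s t, 0 <= s -> s <= t -> F s `<=` F t }.

Definition measurable_at (C : set (set Om)) (d' : measure_display)
    (U : measurableType d') (Y : Om -> U) :=
  forall B, measurable B -> C (Y @^-1` B).

Definition adapted F (J : set R) (d' : measure_display)
    (U : measurableType d') (Y : R -> Om -> U) :=
  forall t, J t -> measurable_at (F t) (Y t).

Definition cvg_in_probability P (Y : nat -> Om -> \bar R) (L : Om -> \bar R) :=
  forall e : R, 0 < e ->
    P [set w | (e%:E <= `|Y n w - L w|)%E] @[n --> \oo] --> 0%E.

(** The nodes of the partition [a :: s]; [node a s k.+1] is [nth _ s k]. *)
Definition node (a : R) (s : seq R) (k : nat) : R := nth 0 (a :: s) k.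

Definition mesh (a : R) (s : seq R) : R :=
  \big[Num.max/0]_(k < size s) (node a s k.+1 - node a s k).

(** [C = [Y, Y']_t]: limit in probability of the sums of products of increments
    along every sequence of deterministic partitions of [0, t] whose mesh tends
    to 0. *)
Definition quadratic_covariation P (t : R) (Y Y' : R -> Om -> R) (C : Om -> R) :=
  forall pi : nat -> seq R,
    (forall n, itv_partition 0 t (pi n)) ->
    mesh 0 (pi n) @[n --> \oo] --> (0 : R) ->
    cvg_in_probability P
      (fun n w => (\sum_(k < size (pi n))
         (Y (node 0 (pi n) k.+1) w - Y (node 0 (pi n) k) w) *
         (Y' (node 0 (pi n) k.+1) w - Y' (node 0 (pi n) k) w))%:E)
      (EFin \o C).

Record wiener F P (W : R -> Om -> R) : Prop := {
  wiener_adapted : adapted F [set t | 0 <= t] W ;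
  wiener0 : {ae P, forall w, W 0 w = 0} ;
  wiener_continuous :
    forall w, {within `[0, +oo[, continuous (fun t => W t w)} ;
  (* [W t - W s] is independent of [F s] with law N(0, t - s); the second
     parameter of [normal_prob] is the standard deviation *)
  wiener_increments : forall s t A B, 0 <= s -> s < t -> F s A -> measurable B ->
    P (A `&` [set w | B (W t w - W s w)]) =
    (P A * normal_prob 0 (Num.sqrt (t - s)) B)%E }.

Definition step_process (s : seq R) (xi : nat -> Om -> R) (t : R) (w : Om) : R :=
  \sum_(k < size s) xi k w * \1_(`]node 0 s k, node 0 s k.+1]%classic) t.

Definition step_integral (s : seq R) (xi : nat -> Om -> R) (W : R -> Om -> R)
    (t : R) (w : Om) : R :=
  \sum_(k < size s) xi k w *
    (W (Num.min t (node 0 s k.+1)) w - W (Num.min t (node 0 s k)) w).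

Definition step_data F (T : R) (s : seq R) (xi : nat -> Om -> R) :=
  itv_partition 0 T s /\
  forall k, (k < size s)%N ->
    (exists C : R, forall w, `|xi k w| <= C) /\
    measurable_at (F (node 0 s k)) (xi k).

(** [M = int H dW] on [0, T]: [M] is the limit in probability of the integrals
    of adapted step processes approximating [H] in L^2([0, T]) in probability.
    This determines [M] up to indistinguishability. *)
Record ito_integral F P (T : R) (W H M : R -> Om -> R) : Prop := {
  ito_adapted : adapted F `[0, T] M ;
  ito_continuous : forall w, {within `[0, T], continuous (fun t => M t w)} ;
  ito_approx : exists (s : nat -> seq R) (xi : nat -> nat -> Om -> R),
    [/\ forall n, step_data F T (s n) (xi n),
        cvg_in_probability P
          (fun n w => \int[lebesgue_measure]_(t in `[0%R, T])
             ((step_process (s n) (xi n) t w - H t w) ^+ 2)%:E)%E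
          (fun=> 0%E) &
        forall t, 0 <= t <= T ->
          cvg_in_probability P
            (fun n w => (step_integral (s n) (xi n) W t w)%:E)
            (fun w => (M t w)%:E)] }.

Record martingale F P (T : R) (L : R -> Om -> R) : Prop := {
  martingale_adapted : adapted F `[0, T] L ;
  martingale_integrable : forall t, 0 <= t <= T ->
    P.-integrable setT (EFin \o L t) ;
  martingale_eq : forall s t A, 0 <= s -> s <= t -> t <= T -> F s A ->
    (\int[P]_(w in A) (L t w)%:E = \int[P]_(w in A) (L s w)%:E)%E }.

(** On the compact horizon [0, T] a localizing sequence is a nondecreasing
    sequence of stopping times that almost surely reaches [T]. *)
Definition local_martingale F P (T : R) (L : R -> Om -> R) :=
  adapted F `[0, T] L /\
  exists theta : nat -> Om -> R,
    [/\ forall n w, 0 <= theta n w /\ theta n w <= theta n.+1 w,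
        forall n t, 0 <= t <= T -> F t [set w | theta n w <= t],
        {ae P, forall w, exists n, T <= theta n w} &
        forall n, martingale F P T
          (fun t w => L (Num.min t (theta n w)) w - L 0 w)].

Definition cadlag (T : R) (f : R -> R) :=
  (forall t, 0 <= t < T -> f @ t^'+ --> f t) /\
  (forall t, 0 < t <= T -> cvg (f @ t^'-)).

(** [dS = S (mu dt + vol dW)]; [M] is the martingale part [int S vol dW]. *)
Record risky_asset F P (T : R) (W : R -> Om -> R) (mu : R -> R)
    (vol S M : R -> Om -> R) : Prop := {
  asset_adapted : adapted F `[0, T] S ;
  asset_continuous : forall w, {within `[0, T], continuous (fun t => S t w)} ;
  asset_gt0 : forall t w, 0 <= t <= T -> 0 < S t w ;
  asset_drift : lebesgue_measure.-integrable `[0, T] (EFin \o mu) ;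
  asset_ito : ito_integral F P T W (fun t w => S t w * vol t w) M ;
  asset_sde : {ae P, forall w, forall t, 0 <= t <= T ->
    S t w = S 0 w
      + \int[lebesgue_measure]_(s in `[0, t]) (S s w * mu s) + M t w} }.

(** Foellmer-Schweizer minimal martingale measure for the assets [S1], [S2]
    with [P]-martingale parts [M1], [M2] and bond [expR (r * t)].  Discounting
    multiplies [dM1], [dM2] by a positive deterministic factor, so that it does
    not change orthogonality. *)
Record minimal_martingale_measure F P (Pstar : probability Om R) (T r : R)
    (S1 S2 M1 M2 : R -> Om -> R) : Prop := {
  mmm_equivalent : forall A, measurable A -> (P A = 0%E <-> Pstar A = 0%E) ;
  mmm_initial : forall A, F 0 A -> Pstar A = P A ;
  mmm_discounted1 :
    local_martingale F Pstar T (fun t w => expR (- (r * t)) * S1 t w) ;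
  mmm_discounted2 :
    local_martingale F Pstar T (fun t w => expR (- (r * t)) * S2 t w) ;
  mmm_minimal : forall L : R -> Om -> R,
    martingale F P T L -> (forall w, cadlag T (fun t => L t w)) ->
    (forall t, 0 <= t <= T -> (\int[P]_w (L t w ^+ 2)%:E < +oo)%E) ->
    local_martingale F P T (fun t w => L t w * M1 t w) ->
    local_martingale F P T (fun t w => L t w * M2 t w) ->
    martingale F Pstar T L }.

(** [CovR = [ln S1, ln S2]_T / T = (1/T) int_0^T rho_t vol1_t vol2_t dt]. *)
Record realized_covariance P (T : R) (rho : R -> R)
    (vol1 vol2 S1 S2 : R -> Om -> R) (CovR : Om -> R) : Prop := {
  realized_covariance_measurable : measurable_fun setT CovR ;
  realized_covariance_bracket : quadratic_covariation P T
    (fun t w => ln (S1 t w)) (fun t w => ln (S2 t w)) (fun w => T * CovR w) ;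
  realized_covariance_integral : {ae P, forall w, CovR w =
    T^-1 * \int[lebesgue_measure]_(t in `[0, T])
             (rho t * vol1 t w * vol2 t w)} }.

Definition covariance_swap_value (Pstar : probability Om R) (r T K : R)
    (CovR : Om -> R) : \bar R :=
  ('E_Pstar[(fun w => expR (- (r * T)) * (CovR w - K))%R])%E.

End processes.

Section semi_markov.
Context (R : realType) (dX : measure_display) (X : measurableType dX).

(** [X x R_+] as a subset of [X * R]. *)
Definition phase_space : set (X * R) := [set z | 0 <= z.2].

(** [G x] is a distribution function on [0, +oo[ with density [g x = dG_x/dt].
    A density is only determined, and the derivative of its primitive only
    guaranteed to exist, almost everywhere. *)
Record holding_time_law (G g : X -> R -> R) : Prop := {
  holding_measurable : measurable_fun phase_space (fun z => g z.1 z.2) ;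
  holding_density_ge0 : forall x t, 0 <= t -> 0 <= g x t ;
  holding_cdf : forall x t, 0 <= t ->
    ((G x t)%:E = \int[lebesgue_measure]_(s in `[0%R, t]) (g x s)%:E)%E ;
  holding_derivative : forall x,
    {ae lebesgue_measure, forall t : R, 0 < t -> is_derive t 1 (G x) (g x t)} ;
  holding_total : forall x, G x t @[t --> +oo] --> (1 : R) }.

Definition semi_markov_kernel (Pker : R.-pker X ~> X) (G : X -> R -> R)
    (x : X) (B : set X) (t : R) : \bar R :=
  (Pker x B * (G x t)%:E)%E.

(** The conditional probability identity given [F_n], the history of
    [(x_k, tau_k)_(k <= n)], is stated by integration over the events of
    [F_n]. *)
Record markov_renewal (d : measure_display) (Om : measurableType d)
    (P : probability Om R) (Pker : R.-pker X ~> X) (G : X -> R -> R)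
    (xn : nat -> Om -> X) (tau : nat -> Om -> R) : Prop := {
  renewal_measurable_x : forall n, measurable_fun setT (xn n) ;
  renewal_measurable_tau : forall n, measurable_fun setT (tau n) ;
  renewal_tau0 : forall w, tau 0%N w = 0 ;
  renewal_tau_mono : forall n w, tau n w <= tau n.+1 w ;
  renewal_transition : forall n A B t,
    history [set k | (k <= n)%N] (fun k w => (xn k w, tau k w)) A ->
    measurable B -> 0 <= t ->
    P (A `&` [set w | B (xn n.+1 w) /\ tau n.+1 w - tau n w <= t]) =
    (\int[P]_(w in A) semi_markov_kernel Pker G (xn n w) B t)%E }.

(** [nu(t) = sup {n | tau_n <= t}]; the value is the default [0] on the event
    that the set is unbounded. *)
Definition counting (Om : Type) (tau : nat -> Om -> R) (t : R) (w : Om) : nat :=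
  supremum 0%N [set n : nat | tau n w <= t].

Definition semi_markov_pair (Om : Type) (xn : nat -> Om -> X)
    (tau : nat -> Om -> R) (t : R) (w : Om) : X * R :=
  (xn (counting tau t w) w, t - tau (counting tau t w) w).

(** Difference quotients of [f(x, .)] at [t], within [0, +oo[: two-sided for
    [t > 0], one-sided at [t = 0]. *)
Definition age_quotient (f : X * R -> R) (z : X * R) : set_system R :=
  (fun h => h^-1 * (f (z.1, z.2 + h) - f z)) @
    within [set h | 0 <= z.2 + h] (0 : R)^'.

(** The expression [Q f(x, t)] is meant where [G x t < 1]; a quotient by [0] is
    [0] by the convention of the library. *)
Definition generatorQ (Pker : R.-pker X ~> X) (G g : X -> R -> R)
    (f : X * R -> R) (z : X * R) : R :=
  lim (age_quotient f z) +
  g z.1 z.2 / (1 - G z.1 z.2) * \int[Pker z.1]_y (f (y, 0) - f z).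

Definition generatorQ_defined (Pker : R.-pker X ~> X) (f : X * R -> R) :=
  forall z, phase_space z ->
    cvg (age_quotient f z) /\
    (Pker z.1).-integrable setT (fun y => (f (y, 0))%:E).

(** A Banach space [V] of measurable functions on [X x R_+], presented by the
    evaluation [ev u z] of [u] at [z] (values outside [X x R_+] are
    irrelevant), with continuous point evaluations. *)
Record function_space (V : completeNormedModType R) (ev : V -> X * R -> R)
    : Prop := {
  ev_linear : forall a u v z, phase_space z ->
    ev (a *: u + v) z = a * ev u z + ev v z ;
  ev_inj : forall u v, (forall z, phase_space z -> ev u z = ev v z) -> u = v ;
  ev_measurable : forall u, measurable_fun phase_space (ev u) ;
  ev_continuous : forall z, phase_space z -> continuous (fun u => ev u z) }.

Record C0_semigroup (V : completeNormedModType R) (U : R -> V -> V) : Prop := {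
  semigroup_linear : forall t, 0 <= t -> linear (U t) ;
  semigroup_continuous : forall t, 0 <= t -> continuous (U t) ;
  semigroup0 : forall u, U 0 u = u ;
  semigroupD : forall s t u, 0 <= s -> 0 <= t -> U (s + t) u = U s (U t u) ;
  semigroup_strong : forall u, U t u @[t --> 0^'+] --> u }.

(** [U = e^(tQ)]: the infinitesimal generator of [U], i.e. the strong
    derivative at [0+], is exactly the operator [Q] with domain [dom]. *)
Record generated_by_Q (Pker : R.-pker X ~> X) (G g : X -> R -> R)
    (V : completeNormedModType R) (ev : V -> X * R -> R) (dom : set V)
    (U : R -> V -> V) : Prop := {
  generated_semigroup : C0_semigroup U ;
  generated_domain : forall u,
    dom u <-> cvg (h^-1 *: (U h u - u) @[h --> (0 : R)^'+]) ;
  generated_defined : forall u, dom u -> generatorQ_defined Pker (ev u) ;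
  generated_generator : forall u z, dom u -> phase_space z ->
    ev (lim (h^-1 *: (U h u - u) @[h --> (0 : R)^'+])) z =
    generatorQ Pker G g (ev u) z }.

(** [Z] is, under [P], a Markov process on [X x R_+] started at [z0] with
    generator [Q]: it has a transition function [p] whose operators
    [u |-> int u(z') p_t(z, dz')] form a semigroup on the function space with
    generator [Q]. *)
Definition markov_process_with_generator (d : measure_display)
    (Om : measurableType d) (P : probability Om R) (Z : R -> Om -> X * R)
    (Pker : R.-pker X ~> X) (G g : X -> R -> R)
    (V : completeNormedModType R) (ev : V -> X * R -> R) (dom : set V)
    (z0 : X * R) :=
  {ae P, forall w, Z 0 w = z0} /\
  exists (p : R -> R.-pker (X * R)%type ~> (X * R)%type) (Pt : R -> V -> V),
    [/\ forall t z, 0 <= t -> phase_space z -> p t z phase_space = 1%E,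
        forall s t z B, 0 <= s -> 0 <= t -> phase_space z -> measurable B ->
          p (s + t) z B = (\int[p s z]_z' p t z' B)%E,
        forall s t A B, 0 <= s -> s <= t ->
          history `[0, s] Z A -> measurable B ->
          P (A `&` Z t @^-1` B) = (\int[P]_(w in A) p (t - s)%R (Z s w) B)%E,
        forall t u z, 0 <= t -> phase_space z ->
          (p t z).-integrable phase_space (EFin \o ev u) /\
          ev (Pt t u) z = \int[p t z]_(z' in phase_space) ev u z' &
        generated_by_Q Pker G g ev dom Pt].

End semi_markov.

Arguments phase_space {R dX X}.

(* Main.v *)
(** The expectation of the realized covariance is [T^-1] times the integral over
    [0, T] of [rho_t * E[sigma1 sigma2 (x_t, gamma(t))]] by Fubini, the pair process
    being jointly measurable because [nu(t) = n] means [tau_n <= t < tau_(n+1)].  By the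
    Markov property the inner expectation is [P_t (sigma1 sigma2) (x, 0)] for the
    transition semigroup [P_t] of the pair.  It remains to see that [P_t = e^(tQ)]:
    a C0-semigroup is determined by its generator.  The Riemann sums of
    [h^-1 * int_0^h U s u ds] converge to elements of the domain of the generator,
    which is therefore dense, and on the domain two semigroups [U], [W] with the same
    generator agree since [s |-> U (t - s) (W s u)] has right derivative 0. *)

Require Import Defs.
From HB Require Import structures.
From mathcomp Require Import all_boot all_order all_algebra.
From mathcomp Require Import all_classical all_reals all_analysis.
From mathcomp Require Import measurable_realfun.
From mathcomp Require Import ring lra.

Import Order.TTheory GRing.Theory Num.Theory.
Import numFieldNormedType.Exports.

Local Open Scope classical_set_scope.
Local Open Scope ring_scope.

(** * Strongly continuous semigroups: local boundedness, averages of orbits, density of the domain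
    of the generator *)

Section c0_semigroup_theory.
Context {R : realType} {V : completeNormedModType R} (U : R -> V -> V).
Hypothesis hU : C0_semigroup U.
Implicit Types (s t h e : R) (u v w : V).

Lemma semigroupB t u v : 0 <= t -> U t (u - v) = U t u - U t v.
Proof.
move=> t0; have L := semigroup_linear hU t0.
by have := L (-1) v u; rewrite !scaleN1r ![- _ + _]addrC.
Qed.

Lemma semigroup_zero t : 0 <= t -> U t 0 = 0.
Proof. by move=> t0; have := semigroupB t 0 0 t0; rewrite !subrr. Qed.

Lemma semigroupZ t (a : R) u : 0 <= t -> U t (a *: u) = a *: U t u.
Proof.
move=> t0; have := semigroup_linear hU t0 a u 0.
by rewrite addr0 semigroup_zero// addr0.
Qed.

Lemma semigroup_sum t n (f : nat -> V) : 0 <= t ->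
  U t (\sum_(k < n) f k) = \sum_(k < n) U t (f k).
Proof.
move=> t0; elim: n => [|n IH]; first by rewrite !big_ord0 semigroup_zero.
have := semigroup_linear hU t0 1 (\sum_(k < n) f k) (f n).
by rewrite !big_ord_recr/= !scale1r IH.
Qed.

Lemma semigroup_near0 u e : 0 < e ->
  exists2 d, 0 < d & forall s, 0 <= s <= d -> `|U s u - u| <= e.
Proof.
move=> e0; have /cvgrPdist_le/(_ e e0) := @semigroup_strong _ _ _ hU u.
case => d /= d0 hd; exists (d / 2); first by rewrite divr_gt0.
move=> s /andP[]; rewrite le_eqVlt => /predU1P[<- _|s0 sd].
  by rewrite (semigroup0 hU) subrr normr0 ltW.
rewrite distrC; apply: hd => //=.
rewrite sub0r normrN gtr0_norm// (le_lt_trans sd)// ltr_pdivrMr//.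
by rewrite mulr_natr mulr2n ltrDl.
Qed.

Lemma semigroup_bounded_fun_norm t : 0 <= t -> bounded_fun_norm (U t).
Proof.
move=> t0.
pose f : {linear V -> V} :=
  HB.pack (U t) (GRing.isLinear.Build _ _ _ _ _ (semigroup_linear hU t0)).
exact/(bounded_funP f)/linear_bounded_continuous/(semigroup_continuous hU t0).
Qed.

(** By Banach-Steinhaus: without a uniform bound there are times [s n <= 1 / (n + 1)] and vectors
    that [U (s n)] stretches by more than [n + 1], while strong continuity at [0+] keeps each orbit
    bounded along [s n]. *)
Lemma semigroup_bounded_near0 :
  exists d B, [/\ 0 < d, 1 <= B & forall s u, 0 <= s <= d -> `|U s u| <= B * `|u|].
Proof.
apply: contrapT => nb.
have bad n : exists su : R * V, 0 <= su.1 <= n.+1%:R^-1 /\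
    n.+1%:R * `|su.2| < `|U su.1 su.2|.
  apply: contrapT => nbad; apply: nb; exists (n.+1%:R^-1), n.+1%:R.
  split; [by rewrite invr_gt0|by rewrite ler1n|move=> s u hs].
  by rewrite leNgt; apply/negP => lt; apply: nbad; exists (s, u).
have {bad}[su hsu] := choice bad.
pose s n := (su n).1; pose u n := (su n).2.
have s0 n : 0 <= s n by have [/andP[]] := hsu n.
have [||M hM] := @Banach_Steinhauss R V V [set U (s n) | n in setT] _ _ 1.
- move=> _ [n _ <-]; split; [exact: semigroup_bounded_fun_norm|].
  exact: semigroup_linear.
- move=> v; have [d d0 hd] := semigroup_near0 v 1 ltr01.
  pose N := Num.truncn d^-1.
  have d0i : 0 < d^-1 by rewrite invr_gt0.
  have large n : (N <= n)%N -> `|U (s n) v| <= 1 + `|v|.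
    move=> Nn; rewrite -[U _ v](subrK v); apply: (le_trans (ler_normD _ _)).
    rewrite lerD2r; apply: hd; have [/andP[-> +] _] := hsu n => /=.
    move=> /le_trans; apply; rewrite -[leRHS]invrK lef_pV2 ?posrE ?invr_gt0//.
    have /andP[_ /ltW/le_trans] := truncn_itv (ltW d0i).
    by apply; rewrite ler_nat.
  exists (1 + `|v| + \sum_(n < N) `|U (s n) v|) => _ [n _ <-].
  have [Nn|nN] := leqP N n.
    by rewrite (le_trans (large n Nn))// lerDl sumr_ge0.
  rewrite (bigD1 (Ordinal nN))//= addrCA lerDl.
  by rewrite !addr_ge0// sumr_ge0.
pose n := Num.truncn `|M|.
have Mn : `|M| < n.+1%:R by have /andP[] := truncn_itv (normr_ge0 M).
have [_ big] := hsu n.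
have u0 : 0 < `|u n|.
  rewrite normr_gt0; apply/eqP => un0; move: big; rewrite -/(u n) -/(s n) un0.
  by rewrite semigroup_zero// !normr0 mulr0 ltxx.
have := hM _ (ex_intro2 _ _ n I erefl) (`|u n|^-1 *: u n).
rewrite normrZ normfV normr_id mulVf ?gt_eqF// => /(_ (lexx _)).
rewrite semigroupZ// normrZ normfV normr_id ler_pdivrMl//.
apply/negP; rewrite -ltNge; apply: le_lt_trans big.
rewrite mulrC ler_wpM2r// (le_trans (ler_norm _))// ltW//.
Qed.

(** A time at most [k * d] is covered by at most [k] steps of length at most [d], each costing a
    factor [B]. *)
Lemma semigroup_bounded t : exists2 B, 1 <= B &
  forall s u, 0 <= s <= t -> `|U s u| <= B * `|u|.
Proof.
have [d [B [d0 B1 hB]]] := semigroup_bounded_near0.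
have pow k s u : 0 <= s <= k%:R * d -> `|U s u| <= B ^+ k * `|u|.
  elim: k s => [|k IH] s.
    by rewrite mul0r => /le_anti <-; rewrite (semigroup0 hU) expr0 mul1r.
  move=> /andP[s0 sk]; have B0 : 0 <= B by exact: le_trans B1.
  have [sd|ds] := leP s d.
    apply: (le_trans (hB _ _ _)); first by rewrite s0.
    by rewrite ler_wpM2r// exprS ler_peMr// exprn_ege1.
  have sd0 : 0 <= s - d by rewrite subr_ge0 ltW.
  rewrite -(subrK d s) addrC (semigroupD hU)// ?(ltW d0)//.
  apply: (le_trans (hB _ _ _)); first by rewrite lexx ltW.
  rewrite exprS -mulrA ler_wpM2l//; apply: IH; rewrite sd0/= lerBlDr.
  by rewrite -[X in _ + X]mul1r -mulrDl addrC -natr1 addrC in sk *.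
exists (B ^+ (Num.truncn `|t / d|).+1); first exact: exprn_ege1.
move=> s u /andP[s0 st]; apply: pow; rewrite s0/=; apply: (le_trans st).
rewrite -ler_pdivrMr//; apply: (le_trans (ler_norm _)).
by have /andP[_ /ltW] := truncn_itv (normr_ge0 (t / d)).
Qed.

(* For [t = h / n] this is a Riemann sum of [h^-1 * int_0^h U s u ds]; working with
   the sums avoids an integral of [V]-valued functions. *)
Definition orbit_avg (n : nat) (t : R) (u : V) : V :=
  n%:R^-1 *: \sum_(k < n) U (k%:R * t) u.

Lemma orbit_avg_dist n t u e : (0 < n)%N -> 0 <= t ->
  (forall s, 0 <= s <= n%:R * t -> `|U s u - u| <= e) ->
  `|orbit_avg n t u - u| <= e.
Proof.
move=> n0 t0 he; have nR : (0 : R) < n%:R by rewrite ltr0n.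
have -> : orbit_avg n t u - u =
    n%:R^-1 *: \sum_(k < n) (U (k%:R * t) u - u).
  rewrite sumrB scalerBr sumr_const card_ord -[u *+ n]scaler_nat scalerA.
  rewrite mulVf ?gt_eqF//.
  by rewrite scale1r.
rewrite normrZ gtr0_norm ?invr_gt0// ler_pdivrMl//.
apply: (le_trans (ler_norm_sum _ _ _)).
apply: (@le_trans _ _ (\sum_(k < n) e)); last first.
  by rewrite sumr_const card_ord mulr_natl.
apply: ler_sum => k _; apply: he; rewrite mulr_ge0//= ler_wpM2r// ler_nat ltnW//.
Qed.

(** The [n * m] nodes split into [n] blocks of [m] consecutive ones; block [i] is the image of the
    first block under [U (i * (m * t))]. *)
Lemma orbit_avgM n m t u : 0 <= t ->
  orbit_avg (n * m) t u = orbit_avg n (m%:R * t) (orbit_avg m t u).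
Proof.
move=> t0; rewrite /orbit_avg natrM invfM -scalerA; congr (_ *: _).
under [RHS]eq_bigr do rewrite semigroupZ ?mulr_ge0//.
rewrite -scaler_sumr; congr (_ *: _).
elim: n => [|n IH]; first by rewrite mul0n !big_ord0.
rewrite mulSn addnC big_split_ord/= IH big_ord_recr/=; congr (_ + _).
rewrite (semigroup_sum _ m (fun j => U (j%:R * t) u)) ?mulr_ge0//.
apply: eq_bigr => i _.
rewrite -(semigroupD hU) ?mulr_ge0// natrD natrM mulrDl mulrA//.
Qed.

Lemma orbit_avg_norm n t u B : (0 < n)%N -> 0 <= t ->
  (forall s v, 0 <= s <= n%:R * t -> `|U s v| <= B * `|v|) ->
  `|orbit_avg n t u| <= B * `|u|.
Proof.
move=> n0 t0 hB; have nR : (0 : R) < n%:R by rewrite ltr0n.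
rewrite normrZ gtr0_norm ?invr_gt0// ler_pdivrMl//.
apply: (le_trans (ler_norm_sum _ _ _)).
apply: (@le_trans _ _ (\sum_(k < n) (B * `|u|))); last first.
  by rewrite sumr_const card_ord mulr_natl.
apply: ler_sum => k _; apply: hB; rewrite mulr_ge0//= ler_wpM2r// ler_nat ltnW//.
Qed.

Lemma orbit_avgB n t u v : 0 <= t ->
  orbit_avg n t (u - v) = orbit_avg n t u - orbit_avg n t v.
Proof.
move=> t0; rewrite /orbit_avg -scalerBr -sumrB; congr (_ *: _).
by apply: eq_bigr => i _; rewrite semigroupB// mulr_ge0.
Qed.

(** The refined sum is the coarse average of a vector that is itself an average of the orbit over
    the first cell [[0, h / n]], hence within [e] of [u]. *)
Lemma orbit_avg_refine n m h u B e : (0 < n)%N -> (0 < m)%N -> 0 <= h ->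
  (forall s v, 0 <= s <= h -> `|U s v| <= B * `|v|) -> 0 <= B ->
  (forall s, 0 <= s <= h / n%:R -> `|U s u - u| <= e) ->
  `|orbit_avg (n * m) (h / (n * m)%:R) u - orbit_avg n (h / n%:R) u| <= B * e.
Proof.
move=> n0 m0 h0 hB B0 he.
have nR : (n%:R : R) != 0 by rewrite pnatr_eq0 -lt0n.
have mR : (m%:R : R) != 0 by rewrite pnatr_eq0 -lt0n.
have mE : m%:R * (h / (n * m)%:R) = h / n%:R.
  by rewrite natrM; field; rewrite nR mR.
have d0 : 0 <= h / (n * m)%:R by rewrite divr_ge0.
rewrite orbit_avgM// mE -orbit_avgB ?divr_ge0//.
apply: (le_trans (orbit_avg_norm n _ _ B n0 _ _)); rewrite ?divr_ge0//.
  by move=> s v; rewrite mulrC divfK//; exact: hB.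
rewrite ler_wpM2l//; apply: orbit_avg_dist => // s.
by rewrite mE; exact: he.
Qed.

(** The sequence is Cauchy because any two late terms are close to the sum over their common
    refinement. *)
Lemma orbit_avg_cvg h u : 0 <= h ->
  cvgn (fun n => orbit_avg n.+1 (h / n.+1%:R) u).
Proof.
move=> h0; have [B B1 hB] := semigroup_bounded h.
have B0 : 0 < B by exact: lt_le_trans B1.
apply/cauchy_cvgP/cauchy_exP => e e0.
(* Each of the two comparisons with the common refinement costs [B * (e / (4 * B)) = e / 4]. *)
have e4B : 0 < e / (4 * B) by rewrite divr_gt0// mulr_gt0.
have [d d0 hd] := semigroup_near0 u _ e4B.
pose N := Num.truncn (h / d).
have small n : (N <= n)%N -> forall s, 0 <= s <= h / n.+1%:R ->
    `|U s u - u| <= e / (4 * B).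
  move=> Nn s /andP[s0 sh]; apply: hd; rewrite s0/= (le_trans sh)//.
  rewrite ler_pdivrMr ?ltr0n// mulrC -ler_pdivrMr//.
  have /andP[_ /ltW/le_trans] := truncn_itv (divr_ge0 h0 (ltW d0)).
  by apply; rewrite ler_nat.
exists (orbit_avg N.+1 (h / N.+1%:R) u); exists N => // n /= Nn.
rewrite -ball_normE/=.
have := orbit_avg_refine N.+1 n.+1 h u B _ isT isT h0 hB (ltW B0) (small N (leqnn _)).
have := orbit_avg_refine n.+1 N.+1 h u B _ isT isT h0 hB (ltW B0) (small n Nn).
rewrite (mulnC n.+1); set X := orbit_avg (_ * _)%N _ _ => h1 h2.
have eE : B * (e / (4 * B)) = e / 4 by field; rewrite gt_eqF.
rewrite eE in h1 h2; rewrite distrC in h2.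
apply: le_lt_trans (ler_distD X _ _) _.
by apply: le_lt_trans (lerD h2 h1) _; lra.
Qed.

(* The operators [U (m t) - 1] and [sum_(k < n) U (k t)] are both built from
   powers of [U t], and [(x^m - 1) (x^n - 1) / (x - 1)] is symmetric. *)
Lemma orbit_sum_sym n m t u : 0 <= t ->
  U (m%:R * t) (\sum_(k < n) U (k%:R * t) u) - \sum_(k < n) U (k%:R * t) u =
  U (n%:R * t) (\sum_(k < m) U (k%:R * t) u) - \sum_(k < m) U (k%:R * t) u.
Proof.
move=> t0.
have key p q : U (q%:R * t) (\sum_(k < p) U (k%:R * t) u) =
    \sum_(k < q + p) U (k%:R * t) u - \sum_(k < q) U (k%:R * t) u.
  rewrite (semigroup_sum _ p (fun j => U (j%:R * t) u)) ?mulr_ge0//.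
  rewrite big_split_ord/= [X in X - _]addrC addrK.
  by apply: eq_bigr => i _; rewrite -(semigroupD hU) ?mulr_ge0// natrD mulrDl.
by rewrite !key addnC -!addrA; congr (_ + _); rewrite addrC.
Qed.


(** Splitting [U h v - U a x = U a (U (h - a) v - v) + U a (v - x)] and bounding [U] on [[0, h]]
    reduces the claim to strong continuity at [0+]. *)
Lemma semigroup_left_cvg h v (a : nat -> R) (x : nat -> V) : 0 <= h ->
  (forall n, 0 <= a n <= h) -> a n @[n --> \oo] --> h -> x n @[n --> \oo] --> v ->
  U (a n) (x n) @[n --> \oo] --> U h v.
Proof.
move=> h0 ha ah xv; have [B B1 hB] := semigroup_bounded h.
have B0 : 0 < B by exact: lt_le_trans B1.
apply/cvgrPdist_le => e e0.
have e20 : 0 < e / (2 * B) by rewrite divr_gt0// mulr_gt0.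
have [d d0 hd] := semigroup_near0 v (e / (2 * B)) e20.
move/cvgrPdist_le : ah => /(_ _ d0) ah.
move/cvgrPdist_le : xv => /(_ _ e20) xv.
near=> n.
have /andP[an0 anh] := ha n.
have -> : U h v - U (a n) (x n) = U (a n) (U (h - a n) v - v) + U (a n) (v - x n).
  rewrite !semigroupB// subrKA -(semigroupD hU) ?subr_ge0//.
  by rewrite [a n + _]addrC subrK.
apply: (le_trans (ler_normD _ _)).
have -> : e = B * (e / (2 * B)) + B * (e / (2 * B)) by field; rewrite gt_eqF.
apply: lerD; apply: (le_trans (hB _ _ (ha n))); rewrite ler_wpM2l ?(ltW B0)//.
- apply: hd; rewrite subr_ge0 anh/=; apply: (le_trans (ler_norm _)); near: n; exact: ah.
- by near: n; exact: xv.
Unshelve. all: by end_near. Qed.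

(** With [v = h^-1 * int_0^h U s u ds], the increment [U d v - v] is [d / h] times [U h - 1] applied
    to the average of the orbit over [[0, d]], which is within [e] of [u]. This is shown on grids of
    step [h / (n + 1)] and passed to the limit. *)
Lemma orbit_avg_increment h d u v e B : 0 < h -> 0 < d ->
  orbit_avg n.+1 (h / n.+1%:R) u @[n --> \oo] --> v ->
  (forall s w, 0 <= s <= h -> `|U s w| <= B * `|w|) -> 0 <= B ->
  (forall s, 0 <= s <= d -> `|U s u - u| <= e) ->
  `|U d v - v - (d / h) *: (U h u - u)| <= (d / h) * ((B + 1) * e).
Proof.
move=> h0 d0 av hB B0 he.
have e0 : 0 <= e.
  by apply: le_trans (he 0 _) => //; rewrite lexx ltW.
pose A n := orbit_avg n.+1 (h / n.+1%:R) u.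
(* [orbit_sum_sym] needs both lengths on the grid, so [d] is replaced by [a n], the largest multiple
   of the step not exceeding it. *)
pose m n := Num.truncn (d / (h / n.+1%:R)).
pose a n := (m n)%:R * (h / n.+1%:R).
have t0 n : 0 < h / n.+1%:R by rewrite divr_gt0.
have ad n : 0 <= a n <= d.
  rewrite mulr_ge0 ?(ltW (t0 _))//= -ler_pdivlMr//.
  by have /andP[] := truncn_itv (ltW (divr_gt0 d0 (t0 n))).
have da n : d - a n <= h / n.+1%:R.
  rewrite lerBlDl /a -[X in _ + X]mul1r -mulrDl -ler_pdivrMr// natr1 ltW//.
  by have /andP[] := truncn_itv (ltW (divr_gt0 d0 (t0 n))).
have ainf : a n @[n --> \oo] --> d.
  have hn : h / n.+1%:R @[n --> \oo] --> (0 : R).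
    rewrite -(mulr0 h); apply: cvgMr; exact: cvg_harmonic.
  apply/cvgrPdist_le => eps eps0; near=> n.
  have /andP[a0 le_ad] := ad n.
  rewrite ger0_norm ?subr_ge0//; apply: (le_trans (da n)).
  near: n; move/cvgrPdist_le : hn => /(_ _ eps0); apply: filterS => n.
  by rewrite sub0r normrN; exact: le_trans (ler_norm _).
have key n : `|U (a n) (A n) - A n - (a n / h) *: (U h u - u)| <=
    (d / h) * ((B + 1) * e).
  have -> : U (a n) (A n) - A n - (a n / h) *: (U h u - u) =
      (a n / h) *: ((U h (orbit_avg (m n) (h / n.+1%:R) u) -
        orbit_avg (m n) (h / n.+1%:R) u) - (U h u - u)).
    rewrite [RHS]scalerBr; congr (_ - _).
    have /andP[a0 _] := ad n.
    have nR : (n.+1%:R : R) != 0 by rewrite pnatr_eq0.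
    have hN : h = n.+1%:R * (h / n.+1%:R) by rewrite mulrC divfK.
    have := orbit_sum_sym n.+1 (m n) (h / n.+1%:R) u (ltW (t0 n)).
    rewrite -hN -/(a n) => E.
    rewrite /A /orbit_avg !semigroupZ ?(ltW h0)// -!scalerBr E scalerA.
    have [m0|m0] := eqVneq (m n) 0%N.
      rewrite m0 big_ord0 semigroup_zero ?(ltW h0)// subr0 scaler0.
      by rewrite !scaler0.
    congr (_ *: _); rewrite /a.
    have mR : ((m n)%:R : R) != 0 by rewrite pnatr_eq0.
    by field; rewrite mR (gt_eqF h0) addrC natr1 nR.
  have /andP[a0 le_ad] := ad n.
  rewrite normrZ ger0_norm ?divr_ge0 ?(ltW h0)//.
  (* The empty average is [0], which need not be close to [u], but then the factor [a n / h] is [0]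
     too. *)
  have [m0|m0] := posnP (m n).
    rewrite /a m0 !mul0r mulr_ge0 ?divr_ge0 ?(ltW h0) ?(ltW d0)//.
    by rewrite mulr_ge0// addr_ge0.
  apply: ler_pM => //; first by rewrite divr_ge0// ltW.
    by rewrite ler_wpM2r// invr_ge0 ltW.
  set w := orbit_avg _ _ _.
  have wu : `|w - u| <= e.
    by apply: orbit_avg_dist; rewrite ?(ltW (t0 n))// => s /andP[s0 sa]; apply: he;
       rewrite s0 (le_trans sa).
  have -> : U h w - w - (U h u - u) = U h (w - u) - (w - u).
    rewrite semigroupB ?(ltW h0)// !opprB !addrA; rewrite addrAC -!addrA.
    by congr (_ + _); rewrite addrC addrA addrAC.
  apply: (le_trans (ler_normB _ _)); rewrite mulrDl mul1r; apply: lerD => //.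
  apply: (le_trans (hB _ _ _)); first by rewrite lexx ltW.
  by rewrite ler_wpM2l.
have lim : `|U (a n) (A n) - A n - (a n / h) *: (U h u - u)| @[n --> \oo] -->
    `|U d v - v - (d / h) *: (U h u - u)|.
  apply: cvg_norm; apply: cvgB; [apply: cvgB => //|].
    exact: semigroup_left_cvg (ltW d0) ad ainf av.
  by apply: cvgZr_tmp; apply: cvgMl.
by apply: (cvgr_to_le lim); near=> n; exact: key.
Unshelve. all: by end_near. Qed.

(** Dividing the bound on the increment by [d] leaves [h^-1 * (B + 1)] times the oscillation of the
    orbit of [u] on [[0, d]], which vanishes with [d]. *)
Lemma orbit_avg_domain h u v : 0 < h ->
  orbit_avg n.+1 (h / n.+1%:R) u @[n --> \oo] --> v ->
  d^-1 *: (U d v - v) @[d --> (0 : R)^'+] --> h^-1 *: (U h u - u).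
Proof.
move=> h0 av; have [B B1 hB] := semigroup_bounded h.
have B0 : 0 <= B by exact: le_trans B1.
apply/cvgrPdist_le => e e0.
have C0 : 0 < h^-1 * (B + 1) by rewrite mulr_gt0 ?invr_gt0// ltr_wpDl.
have [d0 d0_gt0 hd] := semigroup_near0 u _ (divr_gt0 e0 C0).
near=> d.
have dgt0 : 0 < d by near: d; exact: nbhs_right_gt.
have dd0 : d <= d0 by near: d; exact: nbhs_right_le.
have hs s : 0 <= s <= d -> 0 <= s <= d0 by move=> /andP[-> /le_trans]; apply.
have := orbit_avg_increment h d u v _ B h0 dgt0 av hB B0 (fun s ds => hd s (hs s ds)).
have -> : U d v - v - (d / h) *: (U h u - u) =
  d *: (d^-1 *: (U d v - v) - h^-1 *: (U h u - u)).
  by rewrite [RHS]scalerBr !scalerA mulfV ?gt_eqF// scale1r.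
rewrite normrZ gtr0_norm// -mulrA ler_pM2l// distrC => /le_trans; apply.
rewrite mulrA mulrCA mulfV ?gt_eqF// mulr1.
by [].
Unshelve. all: by end_near. Qed.

(** The witness is the limit of the averages over [[0, h]], with [h] so small that the orbit of [u]
    moves by at most [e]. *)
Lemma semigroup_domain_dense u e : 0 < e ->
  exists v, `|v - u| <= e /\ cvg (d^-1 *: (U d v - v) @[d --> (0 : R)^'+]).
Proof.
move=> e0; have [h h0 hh] := semigroup_near0 u e e0.
have /cvg_ex[v av] := orbit_avg_cvg h u (ltW h0).
exists v; split; last by apply/cvg_ex; eexists; exact: orbit_avg_domain h0 av.
have lim : `|orbit_avg n.+1 (h / n.+1%:R) u - u| @[n --> \oo] --> `|v - u|.
  by apply: cvg_norm; apply: cvgB => //; exact: cvg_cst.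
apply: (cvgr_to_le lim); near=> n; apply: orbit_avg_dist => //.
  by rewrite divr_ge0// ltW.
by move=> s; rewrite mulrC divfK//; exact: hh.
Unshelve. all: by end_near. Qed.

(** [U s] is continuous and commutes with the difference quotients. *)
Lemma semigroup_domain_stable s v l : 0 <= s ->
  d^-1 *: (U d v - v) @[d --> (0 : R)^'+] --> l ->
  d^-1 *: (U d (U s v) - U s v) @[d --> (0 : R)^'+] --> U s l.
Proof.
move=> s0 hl.
have : U s (d^-1 *: (U d v - v)) @[d --> (0 : R)^'+] --> U s l.
  by apply: continuous_cvg => //; exact: semigroup_continuous.
apply: cvg_trans; apply: near_eq_cvg; near=> d.
have d0 : 0 <= d by near: d; exact: nbhs_right_ge.
rewrite semigroupZ// semigroupB//; congr (_ *: (_ - _)).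
by rewrite -!(semigroupD hU)// addrC.
Unshelve. all: by end_near. Qed.

End c0_semigroup_theory.

(** * Uniqueness of the semigroup with a given generator *)

Lemma right_growth {R : realType} (f : R -> R) (t e : R) : 0 <= t -> f 0 <= 0 ->
  (forall s eta, 0 < s <= t -> 0 < eta -> exists2 d, 0 < d &
     forall r, 0 <= r <= s -> s - r <= d -> f s <= f r + eta) ->
  (forall s, 0 <= s < t -> exists2 d, 0 < d &
     forall r, s <= r <= t -> r - s <= d -> f r <= f s + e * (r - s)) ->
  f t <= e * t.
Proof.
move=> t0 f0 fl fr.
(* Continuous induction: the control from the left puts [c = sup A] into [A], and the control from
   the right would extend [A] beyond [c] if [c < t]. *)
pose A := [set s | 0 <= s <= t /\ f s <= e * s].
have A0 : A 0 by split; rewrite ?lexx// mulr0.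
have ubA : ubound A t by move=> s [/andP[]].
have supA : has_sup A by split; [exists 0|exists t].
set c := sup A.
have c0 : 0 <= c by exact: (ub_le_sup supA.2).
have ct : c <= t by exact: (ge_sup supA.1).
have Ac : A c.
  split; first exact/andP.
  have [->|cn0] := eqVneq c 0; first by rewrite mulr0.
  have cgt0 : 0 < c by rewrite lt0r cn0.
  apply/ler_addgt0Pr => eta eta0.
  have [||d d0 hd] := fl c (eta / 2); rewrite ?cgt0 ?divr_gt0//.
  (* Half of [eta] pays for [f c - f r], the other half for [e * r - e * c]; [1 + |e|] keeps the
     quotient defined for [e = 0]. *)
  pose d' := Num.min d (eta / (2 * (1 + `|e|))).
  have e1 : 0 < 1 + `|e| by rewrite ltr_pwDl.
  have d'0 : 0 < d' by rewrite lt_min d0 divr_gt0// mulr_gt0.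
  have [r [/andP[r0 rt] fr'] rc] := sup_adherent d'0 supA.
  have rlec : r <= c by apply: (ub_le_sup supA.2); split => //; apply/andP.
  have crd : c - r <= d' by rewrite lerBlDr -lerBlDl ltW.
  apply: (le_trans (hd r _ _)); first by rewrite r0.
    by apply: (le_trans crd); rewrite ge_min lexx.
  have : e * r <= e * c + eta / 2.
    rewrite -lerBlDl -mulrBr; apply: (le_trans (ler_norm _)).
    rewrite normrM distrC (@ger0_norm _ (c - r)) ?subr_ge0//.
    apply: (@le_trans _ _ ((1 + `|e|) * d')).
      by apply: ler_pM; rewrite ?subr_ge0// lerDr.
    rewrite mulrC -ler_pdivlMr// ge_min; apply/orP; right.
    by rewrite le_eqVlt; apply/orP; left; apply/eqP; field; rewrite gt_eqF.
  lra.
apply: contrapT => nt.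
have clt : c < t.
  rewrite lt_neqAle ct andbT; apply/eqP => ce; apply: nt.
  by rewrite -ce; exact: Ac.2.
have [|d d0 hd] := fr c; first by rewrite c0.
pose r := Num.min t (c + d).
have cr : c < r by rewrite lt_min clt ltrDl.
have Ar : A r.
  have rt : r <= t by rewrite ge_min lexx.
  split; first by rewrite (le_trans c0 (ltW cr)).
  apply: (le_trans (hd r _ _)).
  - by rewrite (ltW cr).
  - by rewrite lerBlDl ge_min lexx orbT.
  have := Ac.2; rewrite mulrBr; lra.
by have := ub_le_sup supA.2 Ar; rewrite leNgt cr.
Qed.

Section c0_semigroup_uniqueness.
Context {R : realType} {V : completeNormedModType R} (U W : R -> V -> V).
Hypotheses (hU : C0_semigroup U) (hW : C0_semigroup W).
Hypothesis hUW : forall u (l : V), d^-1 *: (W d u - u) @[d --> (0 : R)^'+] --> l ->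
  d^-1 *: (U d u - u) @[d --> (0 : R)^'+] --> l.

(** The difference quotients of [W] and [U] at [u] have the same limit, and they differ by
    [(W r u - U r u) / r]. *)
Lemma semigroup_tangent u e : cvg (d^-1 *: (W d u - u) @[d --> (0 : R)^'+]) ->
  0 < e -> exists2 d, 0 < d & forall r, 0 <= r <= d -> `|W r u - U r u| <= e * r.
Proof.
move=> /cvg_ex[l Wl] e0; have Ul := hUW u l Wl.
have : (d^-1 *: (W d u - u) - d^-1 *: (U d u - u)) @[d --> (0 : R)^'+] --> l - l.
  exact: cvgB.
rewrite subrr => /cvgrPdist_le/(_ e e0) -[d /= d0 hd].
exists (d / 2); first by rewrite divr_gt0.
move=> r /andP[]; rewrite le_eqVlt => /predU1P[<- _|r0 rd].
  by rewrite (semigroup0 hU) (semigroup0 hW) subrr normr0 mulr0.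
have /= := hd r.
rewrite !sub0r !normrN gtr0_norm// -scalerBr opprB addrA subrK => /(_ _ r0).
rewrite normrZ gtr0_norm ?invr_gt0// ler_pdivrMl// mulrC; apply.
by rewrite (le_lt_trans rd)// ltr_pdivrMr// mulr_natr mulr2n ltrDl.
Qed.

(* The increments of [s |-> U (t - s) (W s u)] over [s, s + h] are o(h), so that
   this path from [U t u] to [W t u] is constant. *)
Lemma semigroup_unique_domain t u : 0 <= t ->
  cvg (d^-1 *: (W d u - u) @[d --> (0 : R)^'+]) -> W t u = U t u.
Proof.
move=> t0 du.
have [B B1 hB] := semigroup_bounded U hU t.
have [C C1 hC] := semigroup_bounded W hW t.
have B0 : 0 < B by exact: lt_le_trans B1.
have C0 : 0 < C by exact: lt_le_trans C1.
pose phi s := U (t - s) (W s u).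
pose f s := `|phi s - U t u|.
apply/eqP; rewrite -subr_eq0 -normr_le0; apply/ler_addgt0Pr => e e0; rewrite add0r.
have -> : `|W t u - U t u| = f t by rewrite /f /phi subrr (semigroup0 hU).
(* Growth at rate [e / (t + 1)] accumulates to at most [e] over [[0, t]]; the [+ 1] covers
   [t = 0]. *)
have t1 : 0 < t + 1 by rewrite ltr_wpDl.
have et0 : 0 < e / (t + 1) by rewrite divr_gt0.
apply: (@le_trans _ _ (e / (t + 1) * t)); last first.
  by rewrite mulrAC ler_pdivrMr// ler_pM2l// lerDl.
have fdist s r : f s <= f r + `|phi s - phi r|.
  by rewrite [X in _ <= X]addrC; exact: ler_distD.
apply: right_growth => //.
- by rewrite /f /phi subr0 (semigroup0 hW) subrr normr0.
- move=> s eta /andP[s0 st] eta0.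
  pose w := W s u.
  (* The path is split around [w = W s u], fixed while [r] varies, so that the radii do not depend
     on [r]. The [W] part is magnified by [B * B * C] and the [U] part by [B]; each then contributes
     [eta / 2]. *)
  have eta1 : 0 < eta / (2 * (B * (B * C))) by rewrite divr_gt0// !mulr_gt0.
  have eta2 : 0 < eta / (2 * B) by rewrite divr_gt0// !mulr_gt0.
  have [d1 d10 hd1] := semigroup_near0 W hW u _ eta1.
  have [d2 d20 hd2] := semigroup_near0 U hU w _ eta2.
  exists (Num.min d1 d2); first by rewrite lt_min d10.
  move=> r /andP[r0 rs]; rewrite le_min => /andP[sr1 sr2].
  apply: (le_trans (fdist s r)); rewrite lerD2l.
  have sr0 : 0 <= s - r by rewrite subr_ge0.
  have ts0 : 0 <= t - s by rewrite subr_ge0.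
  have -> : phi s - phi r = - U (t - s) (U (s - r) (W r u - w) + (U (s - r) w - w)).
    rewrite (semigroupB U hU (s - r))// addrA subrK (semigroupB U hU)//.
    by rewrite opprB /phi -(semigroupD hU)// addrA subrK.
  rewrite normrN; apply: (le_trans (hB _ _ _)).
    by rewrite ts0 lerBlDr lerDl ltW.
  apply: (@le_trans _ _ (B * (B * (C * (eta / (2 * (B * (B * C))))) + eta / (2 * B)))).
    rewrite ler_pM2l//; apply: (le_trans (ler_normD _ _)); apply: lerD.
      apply: (le_trans (hB _ _ _)).
        by rewrite sr0 lerBlDr (le_trans st)// lerDl.
      rewrite ler_pM2l//.
      have -> : W r u - w = W r (u - W (s - r) u).
        by rewrite (semigroupB W hW)// -(semigroupD hW)// [r + _]addrC subrK.
      apply: (le_trans (hC _ _ _)); first by rewrite r0 (le_trans rs).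
      rewrite ler_pM2l// distrC; apply: hd1.
      by rewrite sr0.
    by apply: hd2; rewrite sr0.
  by rewrite le_eqVlt; apply/orP; left; apply/eqP; field; rewrite !gt_eqF.
- move=> s /andP[s0 st].
  have Wsu : cvg (d^-1 *: (W d (W s u) - W s u) @[d --> (0 : R)^'+]).
    case/cvg_ex : du => l hl; apply/cvg_ex; exists (W s l).
    exact: semigroup_domain_stable.
  (* The division by [B] compensates for the operator [U (t - r)] applied afterwards. *)
  have [d d0 hd] := semigroup_tangent (W s u) (e / (t + 1) / B) Wsu (divr_gt0 et0 B0).
  exists d => // r /andP[sr rt] rsd.
  apply: (le_trans (fdist r s)); rewrite lerD2l.
  have rs0 : 0 <= r - s by rewrite subr_ge0.
  have tr0 : 0 <= t - r by rewrite subr_ge0.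
  have -> : phi r - phi s = U (t - r) (W (r - s) (W s u) - U (r - s) (W s u)).
    rewrite (semigroupB U hU)// -(semigroupD hU)// -(semigroupD hW)//.
    by rewrite !subrK addrA subrK.
  apply: (le_trans (hB _ _ _)).
    by rewrite tr0 lerBlDr lerDl (le_trans s0).
  apply: (@le_trans _ _ (B * (e / (t + 1) / B * (r - s)))).
    by rewrite ler_pM2l//; apply: hd; rewrite rs0.
  by rewrite mulrA [B * _]mulrC divfK ?gt_eqF.
Qed.

(** By density: replacing [u] by a [v] of the domain, where both agree, costs at most
    [(B + C) * |v - u|]. *)
Lemma semigroup_unique t u : 0 <= t -> W t u = U t u.
Proof.
move=> t0.
have [B B1 hB] := semigroup_bounded U hU t.
have [C C1 hC] := semigroup_bounded W hW t.
have BC0 : 0 < B + C by rewrite addr_gt0// (lt_le_trans _ B1, lt_le_trans _ C1).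
apply/eqP; rewrite -subr_eq0 -normr_le0; apply/ler_addgt0Pr => e e0; rewrite add0r.
have [v [vu dv]] := semigroup_domain_dense W hW u _ (divr_gt0 e0 BC0).
have -> : W t u - U t u = U t (v - u) - W t (v - u).
  rewrite (semigroupB U hU)// (semigroupB W hW)// (semigroup_unique_domain t v)//.
  by rewrite opprB [RHS]addrC subrKA.
apply: (le_trans (ler_normB _ _)).
have tt : 0 <= t <= t by rewrite t0 lexx.
apply: (le_trans (lerD (hB _ _ tt) (hC _ _ tt))).
by rewrite -mulrDl mulrC -ler_pdivlMr.
Qed.

End c0_semigroup_uniqueness.

(** * Measurability of the semi-Markov pair *)

Lemma measurable_set_le {R : realType} {d : measure_display} {T : measurableType d}
  (f g : T -> R) : measurable_fun setT f -> measurable_fun setT g ->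
  measurable [set z | f z <= g z].
Proof.
move=> mf mg; rewrite -[X in measurable X]setTI.
rewrite (_ : [set z | _] = (fun z => f z <= g z) @^-1` [set true])//.
by apply: (measurable_fun_ler mf mg).

Qed.

Lemma measurable_set_lt {R : realType} {d : measure_display} {T : measurableType d}
  (f g : T -> R) : measurable_fun setT f -> measurable_fun setT g ->
  measurable [set z | f z < g z].
Proof.
move=> mf mg; rewrite -[X in measurable X]setTI.
rewrite (_ : [set z | _] = (fun z => f z < g z) @^-1` [set true])//.
by apply: (measurable_fun_ltr mf mg).

Qed.

Section semi_markov_pair_measurability.
Context {R : realType} {dX dO : measure_display}.
Context {X : measurableType dX} {Om : measurableType dO}.
Variables (xn : nat -> Om -> X) (tau : nat -> Om -> R).
Hypothesis tau_mono : forall n w, tau n w <= tau n.+1 w.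
Hypothesis tau0 : forall w, tau 0%N w = 0.

Lemma renewal_time_mono w m n : (m <= n)%N -> tau m w <= tau n w.
Proof.
by move=> mn; apply: (@homo_leq _ (tau^~ w) <=%R) mn => // y x z; exact: le_trans.
Qed.

Lemma counting_eq n t w : tau n w <= t -> t < tau n.+1 w -> Defs.counting tau t w = n.
Proof.
move=> nt tn; rewrite /Defs.counting /supremum ifF; last first.
  by apply/eqP => /seteqP[/(_ n nt)].
apply: xget_subset1; last exact: is_subset1_supremums.
split => [k /= kt|k]; last exact.
by rewrite leEnat leqNgt; apply/negP => /(renewal_time_mono w) /(lt_le_trans tn);
  rewrite ltNge kt.
Qed.

(** Jump times may accumulate on individual paths, so the default value of [supremum] has to be
    tracked. *)
Lemma counting_unbounded t w : (forall n, tau n w <= t) -> Defs.counting tau t w = 0%N.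
Proof.
move=> nt; apply: supremum_out => -[_ [n]] /(_ n.+1 (nt n.+1)).
by rewrite leEnat ltnn.
Qed.

Lemma countingP n t w : 0 <= t ->
  Defs.counting tau t w = n <->
  (tau n w <= t < tau n.+1 w) \/ (n = 0%N /\ forall k, tau k w <= t).
Proof.
move=> t0; have [ub|nub] := pselect (forall k, tau k w <= t).
  rewrite counting_unbounded//; split => [<-|[/andP[_]|[]//]]; first by right.
  by rewrite ltNge ub.
have {}ex : exists k, t < tau k w.
  apply: contrapT => nex; apply: nub => k; rewrite leNgt.
  by apply/negP => kt; apply: nex; exists k.
(* The least index with [t < tau k w] is positive since [tau 0 w = 0 <= t]; its predecessor is the
   count. *)
have [k tk kmin] := ex_minnP ex.
case: k tk kmin => [|k tk kmin]; first by rewrite tau0 ltNge t0.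
have kt : tau k w <= t by rewrite leNgt; apply/negP => /kmin; rewrite ltnn.
rewrite (counting_eq _ _ _ kt tk); split => [<-|[/andP[nt tn]|[_ /nub]//]].
  by left; rewrite kt.
by rewrite -(counting_eq _ _ _ nt tn) (counting_eq _ _ _ kt tk).
Qed.

Lemma counting_ge0 t w : 0 <= t -> tau (Defs.counting tau t w) w <= t.
Proof.
move=> t0; have /(countingP _ _ _ t0)[/andP[]//|[_]] := erefl (Defs.counting tau t w).
exact.
Qed.

Lemma semi_markov_pair_phase t w : 0 <= t ->
  phase_space (semi_markov_pair xn tau t w).
Proof. by move=> t0; rewrite /phase_space/= subr_ge0 counting_ge0. Qed.

Hypothesis mxn : forall n, measurable_fun setT (xn n).
Hypothesis mtau : forall n, measurable_fun setT (tau n).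

Lemma measurable_semi_markov_pair :
  measurable_fun [set z : Om * R | 0 <= z.2]
    (fun z => semi_markov_pair xn tau z.2 z.1).
Proof.
have mtauT n : measurable_fun setT (fun z : Om * R => tau n z.1).
  by apply: measurableT_comp => //; exact: measurable_fst.
have mle n : measurable [set z : Om * R | tau n z.1 <= z.2].
  by apply: measurable_set_le => //; exact: measurable_snd.
have mlt n : measurable [set z : Om * R | z.2 < tau n z.1].
  by apply: measurable_set_lt => //; exact: measurable_snd.
move=> mD B mB.
(* For times [z.2 >= 0], [E n] is the event that the count is [n]; its second piece assigns the
   paths with all jumps before [z.2] to [n = 0]. On [E n] the pair is [(xn n, t - tau n)]. *)
pose E n := [set z : Om * R | tau n z.1 <= z.2] `&` [set z | z.2 < tau n.+1 z.1] `|`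
  ([set z | n = 0%N] `&` \bigcap_k [set z | tau k z.1 <= z.2]).
have mE n : measurable (E n).
  apply: measurableU; first exact: measurableI.
  apply: measurableI; last exact: bigcapT_measurable.
  have [n0|n0] := pselect (n = 0%N).
    by have -> : [set _ : Om * R | n = 0%N] = setT by apply/seteqP; split.
  by have -> : [set _ : Om * R | n = 0%N] = set0 by apply/seteqP; split.
have -> : [set z : Om * R | 0 <= z.2] `&`
    (fun z => semi_markov_pair xn tau z.2 z.1) @^-1` B =
  \bigcup_n (([set z | 0 <= z.2] `&` E n) `&`
    (fun z => (xn n z.1, z.2 - tau n z.1)) @^-1` B).
  apply/seteqP; split => [[w t] [/= t0 Bz]|[w t] [n _ [[/= t0 En] Bz]]].
    exists (Defs.counting tau t w) => //; split => //; split => //=.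
    have /(countingP _ _ _ t0)[/andP[]|[]] := erefl (Defs.counting tau t w).
      by left.
    by move=> c0 h; right; split => // k _; exact: h.
  split => //=; rewrite /semi_markov_pair (_ : Defs.counting tau t w = n)//.
  apply/(countingP _ _ _ t0); case: En => [[/= -> ->]|[/= n0 h]]; first by left.
  by right; split => // k; exact: h.
apply: bigcupT_measurable => n; apply: measurableI; first exact: measurableI.
rewrite -[X in measurable X]setTI.
apply: (measurable_fun_pair _ _) => //.
  by apply: measurableT_comp => //; exact: measurable_fst.
by apply: measurable_funB => //; exact: measurable_snd.
Qed.

Lemma measurable_semi_markov_pair_at t : 0 <= t ->
  measurable_fun setT (semi_markov_pair xn tau t).
Proof.
move=> t0; rewrite (_ : semi_markov_pair _ _ _ =
  (fun z => semi_markov_pair xn tau z.2 z.1) \o (fun w => (w, t)))//.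
apply: measurable_comp measurable_semi_markov_pair _.
- by apply: (measurable_set_le (cst 0)) => //; exact: measurable_snd.
- by move=> _ [w _ <-].
- exact: pair2_measurable.
Qed.

End semi_markov_pair_measurability.

Lemma measurable_phase_space {R : realType} {d : measure_display}
  {X : measurableType d} : measurable (@phase_space R d X).
Proof.
by apply: (measurable_set_le (cst 0)) => //; exact: measurable_snd.
Qed.

(** * Laws of the pair at fixed times, and change of variables for integrands that are measurable
    only on a set carrying the values *)

Section law_transfer.
Context {R : realType} {d d' : measure_display}.
Context {Om : measurableType d} {Y : measurableType d'}.
Variables (mu : {measure set Om -> \bar R}) (nu : {measure set Y -> \bar R}).
Variables (Z : Om -> Y) (D : set Y) (f : Y -> \bar R).
Hypotheses (mZ : measurable_fun setT Z) (mD : measurable D).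
Hypotheses (ZD : forall w, D (Z w)) (mf : measurable_fun D f).
Hypothesis law : forall B, measurable B -> mu (Z @^-1` B) = nu B.

Lemma ge0_integral_law (h : Y -> \bar R) : measurable_fun D h ->
  (forall y, 0 <= h y)%E -> (\int[mu]_w h (Z w) = \int[nu]_(y in D) h y)%E.
Proof.
move=> mh h0; transitivity (\int[pushforward mu Z]_(y in D) h y)%E.
  rewrite (ge0_integral_pushforward mZ)//.
  by congr integral; apply/seteqP; split => // w _; exact: ZD.
by apply: eq_measure_integral => A mA _; rewrite -law.
Qed.

Lemma integral_law : (\int[mu]_w f (Z w) = \int[nu]_(y in D) f y)%E.
Proof.
rewrite integralE [RHS]integralE; congr (_ - _)%E.
  rewrite -ge0_integral_law//; last exact: measurable_funepos.
  by apply: eq_integral => w _; rewrite -[LHS]/((f \o Z)^\+%E w) funepos_comp.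
rewrite -ge0_integral_law//; last exact: measurable_funeneg.
by apply: eq_integral => w _; rewrite -[LHS]/((f \o Z)^\-%E w) funeneg_comp.
Qed.

Lemma integrable_law : nu.-integrable D f -> mu.-integrable setT (f \o Z).
Proof.
move=> /integrableP[_ foo]; apply/integrableP; split.
  by apply: (measurable_comp mD) => //; move=> _ [w _ <-].
rewrite (_ : integral _ _ _ = (\int[mu]_w (abse \o f) (Z w))%E)//.
rewrite ge0_integral_law//; first exact: measurableT_comp.
by move=> y; exact: abse_ge0.
Qed.

End law_transfer.

(** This is the Markov property at [s = 0] for the sure event, where the integrand is almost surely
    constant. *)
Lemma markov_law {R : realType} {d dX : measure_display} {Om : measurableType d}
  {X : measurableType dX} (P : probability Om R) (Z : R -> Om -> X * R)
  (p : R -> R.-pker (X * R)%type ~> (X * R)%type) (z0 : X * R) :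
  measurable_fun setT (Z 0) ->
  {ae P, forall w, Z 0 w = z0} ->
  (forall s t A B, 0 <= s -> s <= t -> history `[0, s] Z A -> measurable B ->
     P (A `&` Z t @^-1` B) = (\int[P]_(w in A) p (t - s)%R (Z s w) B)%E) ->
  forall t B, 0 <= t -> measurable B -> P (Z t @^-1` B) = p t z0 B.
Proof.
move=> mZ0 Z0 hp t B t0 mB.
have := hp 0 t setT B (lexx 0) t0 _ mB; rewrite setTI subr0 => ->; last first.
  by move=> C [[C0 CD _] _]; rewrite -(setD0 setT); exact: CD.
have mp : measurable_fun setT (fun w => p t (Z 0 w) B).
  exact: measurableT_comp (measurable_kernel (p t) B mB) mZ0.
rewrite (@ae_eq_integral _ _ _ _ setT (cst (p t z0 B)))//.
  rewrite integral_cst// -[RHS]mule1; congr (_ * _)%E; exact: probability_setT.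
by apply: filterS Z0 => w -> _.
Qed.

(** Both generators have domain [dom] and the same values at each point of the phase space; [ev_inj]
    lifts this to equality in [V]. *)
Lemma generated_semigroup_unique {R : realType} {dX : measure_display}
  {X : measurableType dX} (Pker : R.-pker X ~> X) (G g : X -> R -> R)
  (V : completeNormedModType R) (ev : V -> X * R -> R) (dom : set V)
  (U W : R -> V -> V) : function_space ev ->
  generated_by_Q Pker G g ev dom U -> generated_by_Q Pker G g ev dom W ->
  forall t u, 0 <= t -> W t u = U t u.
Proof.
move=> hV gU gW; have hU := generated_semigroup gU; have hW := generated_semigroup gW.
apply: semigroup_unique => // u l Wl.
have du : dom u by apply/(generated_domain gW); apply/cvg_ex; exists l.
have Ul : cvg (d^-1 *: (U d u - u) @[d --> (0 : R)^'+]) by exact/(generated_domain gU).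
suff <- : lim (d^-1 *: (U d u - u) @[d --> (0 : R)^'+]) = l by [].
rewrite -[RHS](cvg_lim (@norm_hausdorff _ _) Wl).
apply: (ev_inj hV) => z hz.
by rewrite (generated_generator gU)// (generated_generator gW).
Qed.

(** * Joint measurability of the integrand, and the value of the swap by Fubini *)

Section covariance_integrand.
Context {R : realType} {d d' : measure_display}.
Context {Om : measurableType d} {Y : measurableType d'}.
Variables (T : R) (rho : R -> R) (Z : R -> Om -> Y) (D : set Y) (f : Y -> R).
Hypotheses (mrho : measurable_fun `[0, T] rho) (mD : measurable D).
Hypothesis mf : measurable_fun D f.
Hypothesis ZD : forall t w, 0 <= t -> D (Z t w).
Hypothesis mZ : measurable_fun [set z : Om * R | 0 <= z.2] (fun z => Z z.2 z.1).

Lemma measurable_integrand : measurable_fun setT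
  (fun z : Om * R => ((fun t => (rho t * f (Z t z.1))%:E) \_ `[0, T]) z.2).
Proof.
pose E := [set z : Om * R | z.2 \in `[0, T]].
have mE : measurable E.
  rewrite (_ : E = [set z : Om * R | cst 0 z <= z.2] `&` [set z | z.2 <= cst T z]).
    by apply: measurableI; apply: measurable_set_le => //; exact: measurable_snd.
  by apply/seteqP; split => [z|z [/= z0 zT]]; rewrite /E/= in_itv/=;
    [move=> /andP|rewrite z0].
rewrite (_ : (fun _ => _) = (fun z : Om * R => (rho z.2 * f (Z z.2 z.1))%:E) \_ E).
  apply/(measurable_restrictT _ mE); apply/measurable_EFinP.
  apply: measurable_funM.
    apply: (measurable_comp _ _ mrho) => //; first by move=> _ [z zE <-].
    exact: measurable_funTS measurable_snd.
  apply: (measurable_comp mD _ mf).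
    by move=> _ [z + <-]; rewrite /E/= in_itv/= => /andP[z0 _]; exact: ZD.
  apply: measurable_funS mZ.
    by apply: (measurable_set_le (cst 0)) => //; exact: measurable_snd.
  by move=> z; rewrite /E/= in_itv/= => /andP[].
apply/funext => z; rewrite !patchE.
suff -> : (z.2 \in [set` `[0, T]]) = (z \in E) by [].
by apply/idP/idP; rewrite !inE.
Qed.

End covariance_integrand.

Theorem theorem3 (R : realType) (dX dO : measure_display)
  (X : measurableType dX) (Om : measurableType dO)
  (* semi-Markov kernel *)
  (Pker : R.-pker X ~> X) (G g : X -> R -> R) (hG : holding_time_law G g)
  (* physical and risk-neutral measures, filtration, horizon, bond rate, strike *)
  (P Pstar : probability Om R) (F : R -> set (set Om)) (hF : filtration F)
  (T r Kcov : R) (hT : 0 < T)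
  (* semi-Markov process (x_t, gamma(t)) *)
  (xn : nat -> Om -> X) (tau : nat -> Om -> R) (x : X)
  (hMR : markov_renewal P Pker G xn tau)
  (hx : {ae P, forall w, xn 0%N w = x})
  (hZF : adapted F [set t | 0 <= t] (semi_markov_pair xn tau))
  (* Wiener processes *)
  (w1 w2 : R -> Om -> R) (hw1 : wiener F P w1) (hw2 : wiener F P w2)
  (rho : R -> R)
  (hrho : lebesgue_measure.-integrable `[0, T] (EFin \o rho))
  (hw12 : forall t, 0 <= t <= T -> quadratic_covariation P t w1 w2
     (fun=> \int[lebesgue_measure]_(s in `[0, t]) rho s))
  (hindep : independent_classes P
     (history [set t | 0 <= t] (fun t w => (w1 t w, w2 t w)))
     (history [set t | 0 <= t] (semi_markov_pair xn tau)))
  (* risky assets *)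
  (sigma1 sigma2 : X * R -> R)
  (hs1 : measurable_fun phase_space sigma1)
  (hs2 : measurable_fun phase_space sigma2)
  (mu1 mu2 : R -> R) (S1 S2 M1 M2 : R -> Om -> R)
  (hS1 : risky_asset F P T w1 mu1
     (fun t w => sigma1 (semi_markov_pair xn tau t w)) S1 M1)
  (hS2 : risky_asset F P T w2 mu2
     (fun t w => sigma2 (semi_markov_pair xn tau t w)) S2 M2)
  (hPstar : minimal_martingale_measure F P Pstar T r S1 S2 M1 M2)
  (* the function space, the semigroup e^(tQ) and the function sigma1 sigma2 *)
  (V : completeNormedModType R) (ev : V -> X * R -> R)
  (hV : function_space ev) (dom : set V) (etQ : R -> V -> V)
  (hetQ : generated_by_Q Pker G g ev dom etQ)
  (hMarkov : markov_process_with_generator Pstar (semi_markov_pair xn tau)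
     Pker G g ev dom (x, 0))
  (sigma12 : V)
  (hsigma12 : forall z, phase_space z ->
     ev sigma12 z = sigma1 z * sigma2 z)
  (* realized covariance, with a well-defined risk-neutral expectation *)
  (CovR : Om -> R)
  (hCov : realized_covariance P T rho
     (fun t w => sigma1 (semi_markov_pair xn tau t w))
     (fun t w => sigma2 (semi_markov_pair xn tau t w)) S1 S2 CovR)
  (hint : (\int[Pstar]_w \int[lebesgue_measure]_(t in `[0%R, T])
     (`|rho t * sigma1 (semi_markov_pair xn tau t w)
              * sigma2 (semi_markov_pair xn tau t w)|)%:E < +oo)%E) :
  covariance_swap_value Pstar r T Kcov CovR =
  (expR (- (r * T)) *
    (T^-1 * (\int[lebesgue_measure]_(t in `[0, T])
               (rho t * ev (etQ t sigma12) (x, 0)))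
     - Kcov))%:E.
Proof.
have tm := renewal_tau_mono hMR; have t00 := renewal_tau0 hMR.
have mxn := renewal_measurable_x hMR; have mtau := renewal_measurable_tau hMR.
have mZ := measurable_semi_markov_pair xn tau tm t00 mxn mtau.
have mZt := measurable_semi_markov_pair_at xn tau tm t00 mxn mtau.
have ZD t w : 0 <= t -> phase_space (semi_markov_pair xn tau t w).
  exact: semi_markov_pair_phase.
set Z := semi_markov_pair xn tau in hS1 hS2 hMarkov hCov hint mZ mZt ZD *.
case: hMarkov => Z0 [p [Pt [_ _ pM pev genP]]].
have PtE := generated_semigroup_unique _ _ _ _ _ _ _ _ hV hetQ genP.
have x0D : @phase_space R dX X (x, 0) by rewrite /phase_space/=.
have mphase := @measurable_phase_space R dX X.
have law := markov_law Pstar Z p (x, 0) (mZt 0 (lexx 0)) Z0 pM.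
have mev := ev_measurable hV sigma12.
(* Under [Pstar], [Z t] has law [p t (x, 0)], whose integral of [sigma12] is [Pt t sigma12] at
   [(x, 0)]; uniqueness replaces [Pt] by [etQ]. *)
have evE t : 0 <= t ->
    Pstar.-integrable setT (fun w => (ev sigma12 (Z t w))%:E) /\
    (\int[Pstar]_w (ev sigma12 (Z t w))%:E = (ev (etQ t sigma12) (x, 0%R))%:E)%E.
  move=> t0; have [pint Ept] := pev t sigma12 (x, 0) t0 x0D.
  have mevE : measurable_fun phase_space (EFin \o ev sigma12) by exact/measurable_EFinP.
  have lawt B : measurable B -> Pstar (Z t @^-1` B) = p t (x, 0) B.
    by move=> mB; exact: law.
  have ZDt w := ZD t w t0.
  split.
    apply: (integrable_law Pstar (p t (x, 0)) (Z t) phase_space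
      (EFin \o ev sigma12)) => //; exact: mZt.
  rewrite -(PtE t sigma12 t0) Ept /Rintegral fineK; last exact: integrable_fin_num.
  apply: (integral_law Pstar (p t (x, 0)) (Z t) phase_space
    (EFin \o ev sigma12)) => //; exact: mZt.
have mrho : measurable_fun `[0, T] rho.
  by apply/measurable_EFinP; exact: measurable_int hrho.
pose phi (z : Om * R) := ((fun t => (rho t * ev sigma12 (Z t z.1))%:E) \_ `[0, T]) z.2.
have mF : measurable_fun setT phi by exact: measurable_integrand ZD mZ.
have sE t w : t \in `[0, T] ->
    rho t * sigma1 (Z t w) * sigma2 (Z t w) = rho t * ev sigma12 (Z t w).
  by rewrite in_itv/= => /andP[t0 _]; rewrite hsigma12 ?mulrA//; exact: ZD.
(* [psi] stays extended-real valued: integrability of the path in time is only known almost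
   surely. *)
pose psi w :=
  (\int[lebesgue_measure]_(t in `[0%R, T]) (rho t * ev sigma12 (Z t w))%:E)%E.
have IF w : psi w = (\int[lebesgue_measure]_t phi (w, t))%E.
  by rewrite /psi integral_mkcond.
have iF : (Pstar \x lebesgue_measure)%E.-integrable setT phi.
  apply/integrable12ltyP; first exact: mF.
  apply: le_lt_trans hint.
  rewrite le_eqVlt; apply/orP; left; apply/eqP; apply: eq_integral => w _.
  rewrite [RHS]integral_mkcond; apply: eq_integral => t _.
  rewrite /phi/= !patchE; case: ifPn => [|_]; last by rewrite abse0.
  by rewrite inE => /= tT; rewrite -sE.
have iI : Pstar.-integrable setT psi.
  rewrite (_ : psi = fubini_F lebesgue_measure phi); first exact: integrable_fubini_F.
  by apply/funext => w; rewrite IF.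
pose J := (\int[lebesgue_measure]_(t in `[0%R, T])
    (rho t * ev (etQ t sigma12) (x, 0%R))%:E)%E.
have IJ : (\int[Pstar]_w psi w = J)%E.
  under eq_integral do rewrite IF.
  rewrite (Fubini iF) /J [RHS]integral_mkcond; apply: eq_integral => t _.
  rewrite /phi/= patchE; case: ifPn => [|tn]; last first.
    by under eq_integral do rewrite patchE (negbTE tn); rewrite integral0.
  move=> tT; under eq_integral do rewrite patchE tT.
  move: tT; rewrite inE/= in_itv/= => /andP[t0 _].
  have [iev Eev] := evE t t0.
  under eq_integral do rewrite EFinM.
  by rewrite integralZl// Eev.
(* Finiteness ensures that the real-valued integral in the conclusion, which is [fine J], has the
   value [J]. *)
have Jfin : J \is a fin_num by rewrite -IJ; exact: integrable_fin_num.
have CovE : {ae Pstar, forall w, ((expR (- (r * T)) * (CovR w - Kcov))%:E =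
    (expR (- (r * T)) * T^-1)%:E * psi w - (expR (- (r * T)) * Kcov)%:E)%E}.
  have cov : {ae Pstar, forall w, CovR w = T^-1 * fine (psi w)}.
    (* The integral formula holds off a [P]-null set, which is also [Pstar]-null by equivalence of
       the measures. *)
    have [N [mN N0 NS]] := realized_covariance_integral hCov.
    exists N; split => //; first exact/(mmm_equivalent hPstar mN).
    apply: subset_trans NS => w /= nC; apply: contra_not nC => ->.
    congr (_ * fine _); apply: eq_integral => t; rewrite inE/= => tT.
    by rewrite sE.
  have := integrable_ae measurableT iI.
  apply: filterS2 cov => w -> /(_ I) fI.
  rewrite -[in RHS](fineK fI) -EFinM -EFinB; congr EFin; ring.
rewrite /covariance_swap_value unlock.
rewrite (ae_eq_integral (fun w => (expR (- (r * T)) * T^-1)%:E * psi w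
   - (cst (expR (- (r * T)) * Kcov)%:E w))%E)//.
- rewrite integralB//; last 2 first.
  + exact: integrableZl.
  + exact: finite_measure_integrable_cst.
  rewrite integralZl// IJ -(fineK Jfin).
  rewrite [X in (_ - X)%E](_ : _ = (expR (- (r * T)) * Kcov)%:E).
    rewrite -EFinM -EFinB.
    by congr EFin; rewrite /Rintegral -/J; ring.
  rewrite integral_cst// -[RHS]mule1; congr (_ * _)%E; exact: probability_setT.
- apply/measurable_EFinP; apply: measurable_funM => //; apply: measurable_funB => //.
  exact: realized_covariance_measurable hCov.
- apply: emeasurable_funB => //.
  by apply: measurable_funeM; exact: measurable_int iI.
- by apply: filterS CovE => w -> _.
Qed.
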